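(* For any polynomially convex Reinhardt compact set $K\subset\mathbb{C}^n$ and every open neighborhood $U$ of $K$, there exist $n$ homogeneous polynomials $p_1,\ldots,p_n$ on $\mathbb{C}^n$ of the same degree, with the only common zero at $0$, such that $$K\subset\{z\in\mathbb{C}^n: |p_k(z)|<1,\ 1\le k\le n\}\Subset U.$$
   Context: A set $K\subset\mathbb{C}^n$ is Reinhardt ($n$-circled, multicircled) if $(z_1,\ldots,z_n)\in K$ implies $(e^{i\phi_1}z_1,\ldots,e^{i\phi_n}z_n)\in K$ for all real $\phi_1,\ldots,\phi_n$. A compact set $K\subset\mathbb{C}^n$ is polynomially convex if it equals its polynomial hull $\{z\in\mathbb{C}^n: |p(z)|\le\sup_K|p|\text{ for all polynomials }p\}$. The notation $A\Subset U$ means that the closure of $A$ is compact and contained in $U$. *)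

(* Defs.v *)
From HB Require Import structures.
From mathcomp Require Import all_boot all_order all_algebra.
From mathcomp Require Import complex.
From mathcomp Require Import all_classical all_reals all_analysis.
(* mpoly is imported without its notations: they clash with those of
   all_analysis. *)
From mathcomp Require Import -(notations) mpoly.

Set Implicit Arguments.
Unset Strict Implicit.
Unset Printing Implicit Defensive.

Import Order.TTheory GRing.Theory Num.Theory.
Import numFieldNormedType.Exports.

Local Open Scope classical_set_scope.
Local Open Scope ring_scope.

(* The type annotation matters: R[i] inherits the topology induced by the
   modulus only when it is seen as a numClosedFieldType. *)
Definition C (R : realType) : numClosedFieldType := R[i].

Definition modulus (R : realType) (z : C R) : R := ComplexField.Normc.normc z.

(* e^{i phi} *)
Definition cis (R : realType) (phi : R) : C R := (cos phi +i* sin phi)%C.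

Definition peval (R : realType) (n : nat) (p : mpoly n (C R))
  (z : 'rV[C R]_n) : C R := meval (fun i => z ord0 i) p.

Definition homogeneous (R : realType) (n d : nat)
  (p : mpoly n (C R)) : Prop :=
  p \is @ishomog1 n (C R) d mdeg.

Definition reinhardt (R : realType) (n : nat) (K : set 'rV[C R]_n) : Prop :=
  forall (phi : 'I_n -> R) (z : 'rV[C R]_n),
    K z -> K (\row_i (cis (phi i) * z ord0 i)).

(* The supremum is taken in the extended reals, so that it is the true one
   whether or not |p| is bounded on K; it is -oo when K is empty. *)
Definition polynomial_hull (R : realType) (n : nat) (K : set 'rV[C R]_n) :
    set 'rV[C R]_n :=
  [set z | forall p : mpoly n (C R),
    ((modulus (peval p z))%:E <=
       ereal_sup [set (modulus (peval p w))%:E | w in K])%E].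

Definition polynomially_convex (R : realType) (n : nat)
    (K : set 'rV[C R]_n) : Prop :=
  K = polynomial_hull K.

Definition relatively_compact_in (T : topologicalType) (A U : set T) : Prop :=
  compact (closure A) /\ closure A `<=` U.

(* Main.v *)
(* A monomial hull argument shows that a polynomially convex Reinhardt set K is
   cut out by monomial inequalities, so by compactness there are finitely many
   monomials f_j with coefficients, of one degree, such that K lies in
   {max |f_j| < 1} and a slightly larger set {max |f_j| <= c} is a compact
   subset of U.  After a small change of the coefficients, any n + 1 of the
   affine functions log|f_j| (affine in log|z_i|) are affinely dependent with a
   nonzero constant term, so n + 1 of the |f_j| are never all close to their
   maximum.  The n polynomials are then the elementary symmetric functions of
   orders k = 1, ..., n in the high powers f_j^(q/k): at each z there is a gap
   after the k largest values |f_j(z)| for some k <= n, the product of these k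
   values dominates the k-th polynomial, and hence max_k |p_k| is comparable
   with (max_j |f_j|)^q up to a factor close to 1 to the power q. *)
Require Import Defs.
From HB Require Import structures.
From mathcomp Require Import all_boot all_order all_algebra.
From mathcomp Require Import complex.
From mathcomp Require Import all_classical all_reals all_analysis.
From mathcomp Require Import -(notations) mpoly.
From mathcomp Require Import ring lra.

Set Implicit Arguments.
Unset Strict Implicit.
Unset Printing Implicit Defensive.

Import Order.TTheory GRing.Theory Num.Theory.
Import numFieldNormedType.Exports.

Local Open Scope classical_set_scope.
Local Open Scope ring_scope.

(** * The modulus on the complex numbers and compactness of closed discs *)

Section Modulus.
Variable R : realType.
Implicit Types (x y : C R).

Lemma normCE x : `|x| = ((modulus x)%:C)%C :> C R.
Proof. by case: x. Qed.

Lemma modulus_ge0 x : 0 <= modulus x.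
Proof. by case: x => a b; exact: sqrtr_ge0. Qed.

Lemma modulus0 : modulus (0 : C R) = 0.
Proof. exact: ComplexField.Normc.normc0. Qed.

Lemma modulus1 : modulus (1 : C R) = 1.
Proof. exact: ComplexField.Normc.normc1. Qed.

Lemma modulus_eq0 x : modulus x = 0 -> x = 0.
Proof. exact: ComplexField.Normc.eq0_normc. Qed.

Lemma modulusM x y : modulus (x * y) = modulus x * modulus y.
Proof. exact: ComplexField.Normc.normcM. Qed.

Lemma modulusX x k : modulus (x ^+ k) = modulus x ^+ k.
Proof.
elim: k => [|k IH]; first by rewrite !expr0 modulus1.
by rewrite !exprS modulusM IH.
Qed.

Lemma modulus_prod (I : Type) (s : seq I) (P : pred I) (F : I -> C R) :
  modulus (\prod_(i <- s | P i) F i) = \prod_(i <- s | P i) modulus (F i).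
Proof. by apply: (big_morph (@modulus R));
  [exact: modulusM | exact: modulus1]. Qed.

Lemma modulusD x y : modulus (x + y) <= modulus x + modulus y.
Proof. exact: le_normcD. Qed.

Lemma modulusN x : modulus (- x) = modulus x.
Proof. exact: normcN. Qed.

Lemma modulus_sum (I : Type) (s : seq I) (P : pred I) (F : I -> C R) :
  modulus (\sum_(i <- s | P i) F i) <= \sum_(i <- s | P i) modulus (F i).
Proof.
elim/big_rec2: _ => [|i b a _ le_ab]; first by rewrite modulus0.
by apply: le_trans (modulusD _ _) _; rewrite lerD2l.
Qed.

Lemma modulus_real (a : R) : 0 <= a -> modulus ((a%:C)%C : C R) = a.
Proof. by move=> a0; rewrite /modulus /= expr0n addr0 sqrtr_sqr ger0_norm. Qed.

Lemma modulus_natr k : modulus (k%:R : C R) = k%:R.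
Proof. by rewrite -(rmorph_nat (real_complex R)) modulus_real. Qed.

Lemma modulus_cis (phi : R) : modulus (cis phi) = 1.
Proof. by rewrite /modulus /cis /= cos2Dsin2 sqrtr1. Qed.

Lemma modulusB_ge x y : `|modulus x - modulus y| <= modulus (x - y).
Proof.
have sub (u v : C R) : modulus u - modulus v <= modulus (u - v).
  by rewrite lerBlDr -{1}(subrK v u) modulusD.
by rewrite ler_norml sub andbT lerNl; have := sub y x;
  rewrite -(modulusN (y - x)) !opprB.
Qed.

Lemma ltCE (a b : R) : ((a%:C)%C < (b%:C)%C :> C R) = (a < b).
Proof. exact: ltcR. Qed.

Lemma modulus_continuous : continuous (@modulus R : C R -> R).
Proof.
move=> x; apply/(@cvgrPdist_lt _ _ _ (nbhs x)) => e e0.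
near=> y; apply: le_lt_trans (modulusB_ge _ _) _.
rewrite -ltCE -normCE; near: y.
by apply: (@cvgr_dist_lt _ _ _ (nbhs x)); [exact: cvg_id | rewrite (ltCE 0)].
Unshelve. all: by end_near. Qed.

Lemma mkcomplex_continuous : continuous (fun u : R * R =>
  (u.1 +i* u.2)%C : C R).
Proof.
move=> x; apply/(@cvgrPdist_lt _ _ _ (nbhs x)) => e; case: e => e1 e2.
(* Positivity in the order of [C R] forces the imaginary part to vanish, so epsilon is the real
   number [e1]. *)
move=> e0; have /andP[/eqP e20 e1p] : (e2 == 0) && (0 < e1) := e0.
subst e2.
have e2p : 0 < e1 / 2 by rewrite divr_gt0.
near=> y; rewrite normCE (ltCE _ e1).
have -> : ((x.1 +i* x.2)%C : C R) - (y.1 +i* y.2)%C =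
   (((x.1 - y.1)%:C)%C : C R) + (0 +i* (x.2 - y.2))%C by apply/eqP;
     rewrite eq_complex /= !(addr0,add0r) !eqxx.
apply: le_lt_trans (modulusD _ _) _.
rewrite /modulus /= !expr0n /= addr0 add0r !sqrtr_sqr (splitr e1) ltrD//.
  by near: y; apply: (@cvgr_dist_lt _ _ _ (nbhs x) _ fst x.1) => //;
    exact: cvg_fst.
by near: y; apply: (@cvgr_dist_lt _ _ _ (nbhs x) _ snd x.2) => //;
  exact: cvg_snd.
Unshelve. all: by end_near. Qed.

Lemma closed_disc (r : R) : closed [set x : C R | modulus x <= r].
Proof.
apply: (@closed_comp _ _ (@modulus R) [set t | t <= r]); last exact: closed_le.
by move=> x _; exact: modulus_continuous.
Qed.

Lemma compact_disc (r : R) : compact [set x : C R | modulus x <= r].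
Proof.
(* The disc is closed and lies in the continuous image of this compact square. *)
pose S : set (R * R) := `[- r, r]%classic `*` `[- r, r]%classic.
have cS : compact ((fun u : R * R => (u.1 +i* u.2)%C : C R) @` S).
  apply: continuous_compact; last by apply: compact_setX;
    exact: segment_compact.
  by apply: continuous_subspaceT => x; exact: mkcomplex_continuous.
refine (subclosed_compact (@closed_disc r) cS _) => -[a b] /= ab.
exists (a, b) => //=; split => /=; rewrite in_itv /= -ler_norml -sqrtr_sqr;
  apply: le_trans ab; apply: ler_wsqrtr; rewrite ?lerDl ?lerDr sqr_ge0//.
Qed.

End Modulus.

(** * Moduli of monomials and compact polydiscs *)

Section Monomials.
Variables (R : realType) (n : nat).
Implicit Types (x : 'I_n -> R) (a : multinom n) (z : 'rV[C R]_n).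

Definition absv z : 'I_n -> R := fun i => modulus (z ord0 i).

Definition mono x a : R := \prod_i x i ^+ a i.

Lemma absv_ge0 z i : 0 <= absv z i.
Proof. exact: modulus_ge0. Qed.

Lemma mono_ge0 x a : (forall i, 0 <= x i) -> 0 <= mono x a.
Proof. by move=> x0; apply: prodr_ge0 => i _; rewrite exprn_ge0. Qed.

Lemma mono_mnm0 x : mono x mnm0 = 1.
Proof. by rewrite /mono big1 // => i _; rewrite mnm0E expr0. Qed.

Lemma mono_muln x a k : mono x (mnm_muln a k) = mono x a ^+ k.
Proof.
by rewrite /mono -prodrXl; apply: eq_bigr => i _; rewrite mulmnE exprM.
Qed.

Lemma mono_mnm1 x i : mono x (mnm1 i) = x i.
Proof.
rewrite /mono (bigD1 i) //= mnmE eqxx expr1 big1 ?mulr1 // => j ji.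
by rewrite mnmE eq_sym (negbTE ji) expr0.
Qed.

Lemma modulus_pevalX a z : modulus (peval (mpolyX (C R) a) z) = mono (absv z) a.
Proof.
by rewrite /peval mevalX modulus_prod; apply: eq_bigr => i _; rewrite modulusX.
Qed.

Lemma absv_continuous i : continuous (fun z => absv z i).
Proof.
move=> z; apply: (@continuous_comp _ _ _ (fun u : 'rV[C R]_n =>
  u ord0 i) (@modulus R)).
  exact: (@coord_continuous (C R) 1 n ord0 i).
exact: modulus_continuous.
Qed.

Lemma mono_continuous a : continuous (fun z => mono (absv z) a).
Proof.
suff H (s : seq 'I_n) : continuous (fun z =>
  \prod_(i <- s) absv z i ^+ a i) by exact: H.
elim: s => [|i s IH].
  have -> : (fun z => \prod_(i <- [::]) absv z i ^+ a i) = cst 1.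
    by apply/funext => z; rewrite big_nil.
  by move=> z; exact: cst_continuous.
have -> : (fun z => \prod_(j <- i :: s) absv z j ^+ a j) =
    (fun z => absv z i ^+ a i) \* (fun z => \prod_(j <- s) absv z j ^+ a j).
  by apply/funext => z; rewrite big_cons.
move=> z; apply: (@continuousM _ _ _ _ z); last exact: IH.
exact: (@continuous_comp _ _ _ _ (fun t : R =>
  t ^+ a i) _ (@absv_continuous i z) (@exprn_continuous R (a i) _)).
Qed.

Lemma closed_mono a (r : R) : closed [set z | mono (absv z) a <= r].
Proof.
apply: (@closed_comp _ _ (fun z => mono (absv z) a) [set t | t <= r]);
  last exact: closed_le.
by move=> z _; exact: mono_continuous.
Qed.

Lemma open_mono a (r : R) : open [set z | r < mono (absv z) a].
Proof.
apply: (@open_comp _ _ (fun z => mono (absv z) a) [set t | r < t]);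
  last exact: open_gt.
by move=> z _; exact: mono_continuous.
Qed.

Lemma compact_polydisc (r : R) : compact [set z | forall i, absv z i <= r].
Proof.
exact: (@rV_compact (C R) n (fun _ => [set x : C R | modulus x <= r]) (fun _ =>
  @compact_disc R r)).
Qed.

Lemma compact_absv_bounded (K : set 'rV[C R]_n) : compact K ->
  exists2 r : R, 0 < r & forall z, K z -> forall i, absv z i <= r.
Proof.
move=> cK.
have bi i : exists r : R, forall z, K z -> absv z i <= r.
  have cKi : compact ((fun z => absv z i) @` K).
    apply: continuous_compact cK.
    by apply: continuous_subspaceT => x; exact: absv_continuous.
  have [M [_ HM]] := compact_bounded cKi.
  exists (M + 1) => z Kz; rewrite -[leLHS]ger0_norm ?absv_ge0 //.
  by apply: (HM (M + 1)); [rewrite ltrDl | exists z].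
have {bi} [r rP] := choice bi.
exists (1 + \sum_i `|r i|) => [|z Kz i].
  by rewrite ltr_pwDl // sumr_ge0.
apply: (le_trans (rP i z Kz)); apply: (le_trans (ler_norm _)).
by rewrite (bigD1 i) //= addrCA lerDl addr_ge0 // sumr_ge0.
Qed.

End Monomials.

(** * Roots of unity and orthogonality of characters *)

Section RootsOfUnity.
Variable R : realType.

Lemma cisD (x y : R) : cis (x + y) = cis x * cis y :> C R.
Proof.
rewrite /cis; apply/eqP; rewrite eq_complex /= cosD sinD; apply/andP; split;
  apply/eqP => //.
by rewrite addrC.
Qed.

Lemma cisX (x : R) k : cis x ^+ k = cis (x *+ k).
Proof.
elim: k => [|k IH]; first by rewrite expr0 mulr0n /cis cos0 sin0.
by rewrite exprS mulrS cisD IH.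
Qed.

(** By the half-angle formula cos x = 1 - 2 sin(x/2)^2, where sin is positive on the open interval
    from 0 to pi. *)
Lemma cis_neq1 (x : R) : 0 < x < pi *+ 2 -> cis x != 1.
Proof.
move=> /andP[x0 x2]; apply/eqP => -[cx1 _].
have s0 : 0 < sin (x / 2).
  by rewrite sin_gt0_pi // divr_gt0 //= ltr_pdivrMr // mulr_natr.
have := cx1; rewrite [x in cos x]splitr -mulr2n cos_mulr2n cos2sin2 => /eqP.
rewrite -subr_eq0 (_ : _ - 1 = - (sin (x / 2) ^+ 2 *+ 2)); last by ring.
by rewrite oppr_eq0 mulrn_eq0 /= sqrf_eq0 (gt_eqF s0).
Qed.

(** A geometric sum of ratio w^b / w^c. Since |b - c| <= e < e + 1, this (e+1)-th root of unity is 1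
    only if b = c. *)
Lemma sum_cis_character (e b c : nat) : (b <= e)%N -> (c <= e)%N ->
  let w := cis (pi *+ 2 / e.+1%:R) : C R in
  \sum_(k < e.+1) (w ^+ k) ^+ b / (w ^+ k) ^+ c = (if b == c then e.+1%:R else
    0).
Proof.
move=> be ce w.
have w1 : w ^+ e.+1 = 1.
  rewrite cisX -[X in cis X]mulr_natr -mulrA mulVf ?pnatr_eq0 // mulr1.
  by rewrite /cis cos2pi sin2pi.
have w0 k : w ^+ k != 0.
  by apply/eqP => /(congr1 (@modulus R));
    rewrite modulusX modulus_cis expr1n modulus0 => /eqP; rewrite oner_eq0.
have wk k : (0 < k <= e)%N -> w ^+ k != 1.
  move=> /andP[k0 ke]; rewrite cisX; apply: cis_neq1.
  have p2 : 0 < pi *+ 2 :> R by rewrite mulrn_wgt0 // pi_gt0.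
  by rewrite pmulrn_lgt0 // divr_gt0 //= -[X in X < _]mulr_natr mulrAC
    ltr_pdivrMr // ltr_pM2l // ltr_nat ltnS.
pose zeta := w ^+ b / w ^+ c.
transitivity (\sum_(k < e.+1) zeta ^+ k).
  by apply: eq_bigr => k _; rewrite /zeta expr_div_n -!exprM ![(k * _)%N]mulnC.
have [bc|bc] := eqVneq b c.
  by rewrite /zeta bc divff // (eq_bigr (fun=> 1)) => [|k _];
    rewrite ?expr1n // sumr_const card_ord.
have z1 : zeta != 1.
  rewrite /zeta; wlog bltc : b c be ce bc {zeta} / (b < c)%N => [H|].
    have [|cb] := ltnP b c; first exact: H.
    rewrite -(inj_eq invr_inj) invf_div invr1; apply: H => //;
      first by rewrite eq_sym.
    by rewrite ltn_neqAle eq_sym bc.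
  rewrite -(inj_eq invr_inj) invf_div invr1 -(subnK (ltnW bltc)) exprD mulfK //.
  by apply: wk; rewrite subn_gt0 bltc (leq_trans (leq_subr _ _)).
have /eqP := subrX1 zeta e.+1.
rewrite /zeta expr_div_n -!exprM ![(_ * e.+1)%N]mulnC !exprM w1 !expr1n divr1
  subrr eq_sym.
by rewrite mulf_eq0 subr_eq0 (negbTE z1) => /eqP.
Qed.

End RootsOfUnity.

(** * Cauchy estimates and bounds by counting monomials *)

Section CauchyEstimates.
Variables (R : realType) (n : nat).
Implicit Types (q : mpoly n (C R)) (a : multinom n) (z w : 'rV[C R]_n).

(* The average over the torus is replaced by an average over tuples of roots of
   unity of an order exceeding all the degrees involved. *)
Lemma cauchy_estimate q w (M : R) :
  (forall phi : 'I_n -> R, modulus (peval q (\row_i (cis (phi i) * w ord0 i)))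
    <= M) ->
  forall a, modulus (mcoeff a q) * mono (absv w) a <= M.
Proof.
move=> qM a.
(* [e] bounds all exponents in [q] and in [a], so the roots of unity of order e + 1 tell them
   apart. *)
pose e := maxn (mmeasure mdeg q) (mdeg a).
have supp_le m : m \in msupp q -> forall i, (m i <= e)%N.
  move=> mq i; apply: (leq_trans (leq_trans _ (ltnW (msize_mdeg_lt mq)))
    (leq_maxl _ _)).
  by rewrite mdegE (bigD1 i) //= leq_addr.
have a_le i : (a i <= e)%N.
  apply: leq_trans (leq_maxr _ _).
  by rewrite mdegE (bigD1 i) //= leq_addr.
pose om : C R := cis (pi *+ 2 / e.+1%:R).
pose rot (k : {ffun 'I_n -> 'I_e.+1}) : 'rV[C R]_n :=
  \row_i (om ^+ k i * w ord0 i).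
(* A discrete Fourier sum over the torus: only the monomial of exponent [a] survives in it. *)
pose S := \sum_(k : {ffun 'I_n -> 'I_e.+1})
  (\prod_i (om ^+ k i) ^+ a i)^-1 * peval q (rot k).
have SE : S = mcoeff a q * \prod_i (w ord0 i) ^+ a i * (e.+1%:R ^+ n).
  transitivity (\sum_(m <- msupp q) mcoeff m q * (\prod_i (w ord0 i) ^+ m i) *
     \prod_i \sum_(k < e.+1) (om ^+ k) ^+ m i / (om ^+ k) ^+ a i).
    under [RHS]eq_bigr => m _ do rewrite bigA_distr_bigA mulr_sumr.
    rewrite exchange_big; apply: eq_bigr => k _ /=.
    rewrite /peval mevalE mulr_sumr; apply: eq_bigr => m _.
    under [X in _ * (_ * X)]eq_bigr => i _ do rewrite /rot mxE exprMn.
    rewrite !big_split /= prodfV; ring.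
  have sumE m : m \in msupp q ->
    \prod_i \sum_(k < e.+1) (om ^+ k) ^+ m i / (om ^+ k) ^+ a i =
      if m == a then e.+1%:R ^+ n else 0 :> C R.
    move=> mq; have [->|/eqP ma] := eqVneq m a.
      under eq_bigr => i _ do rewrite sum_cis_character // eqxx.
      by rewrite prodr_const card_ord.
    have [i mai] : exists i, m i != a i.
      apply/existsP; rewrite -negb_forall; apply/negP => /forallP H; apply: ma.
      by apply/mnmP => i; exact/eqP.
    by apply/eqP/prodf_eq0; exists i => //;
      rewrite sum_cis_character ?(supp_le m mq) // (negbTE mai).
  have [aq|aq] := boolP (a \in msupp q); last first.
    rewrite (memN_msupp_eq0 aq) !mul0r big_seq big1 // => m mq; rewrite sumE //.
    by case: eqP => [ma|_]; rewrite ?mulr0 //; rewrite -ma mq in aq.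
  rewrite (bigD1_seq a) //= sumE // eqxx -[RHS]addr0; congr (_ + _).
  rewrite big_seq_cond big1 // => m.
  by move=> /andP[mq ma]; rewrite sumE // (negbTE ma) mulr0.
have Sle : modulus S <= (e.+1%:R ^+ n) * M.
  apply: le_trans (modulus_sum _ _ _) _.
  have -> : e.+1%:R ^+ n * M = \sum_(k : {ffun 'I_n -> 'I_e.+1}) M.
    by rewrite sumr_const card_ffun !card_ord -[RHS]mulr_natl natrX.
  apply: ler_sum => k _.
  rewrite modulusM -prodfV modulus_prod big1 ?mul1r => [|i _].
    have -> : rot k = \row_i (cis ((pi *+ 2 / e.+1%:R) *+ k i) * w ord0 i).
      by apply/rowP => i; rewrite !mxE cisX.
    exact: qM.
  have -> (x : C R) : modulus x^-1 = (modulus x)^-1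
    by exact: ComplexField.Normc.normcV.
  by rewrite !modulusX modulus_cis !expr1n invr1.
move: Sle; rewrite SE !modulusM modulusX modulus_natr mulrC ler_pM2l ?exprn_gt0
  //.
by rewrite modulus_prod (eq_bigr (fun i => absv w i ^+ a i)) // => i _;
  rewrite modulusX.
Qed.

(** The measure is the degree plus 1 (and 0 for q = 0), so each exponent is below [E] and the
    support embeds in the n-tuples with entries below [E]. *)
Lemma size_msupp_le q (E : nat) : (mmeasure mdeg q <= E)%N ->
  (size (msupp q) <= E ^ n)%N.
Proof.
case: E => [|e] qE.
  move: qE; rewrite leqn0 mmeasure_poly_eq0 => /eqP ->.
  by rewrite msupp0.
pose f (m : multinom n) : {ffun 'I_n -> 'I_e.+1} := [ffun i => inord (m i)].
have f_inj : {in msupp q &, injective f}.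
  move=> m1 m2 m1q m2q /ffunP fE; apply/mnmP => i.
  have le m : m \in msupp q -> (m i < e.+1)%N.
    move=> mq; apply: leq_trans (leq_trans (msize_mdeg_lt mq) qE).
    by rewrite ltnS mdegE (bigD1 i) //= leq_addr.
  by have := fE i; rewrite !ffunE => /(congr1 (@nat_of_ord _));
    rewrite !inordK ?le.
have U : uniq (map f (msupp q)) by rewrite map_inj_in_uniq ?msupp_uniq.
rewrite -(size_map f) -(card_uniqP U).
by apply: leq_trans (max_card _) _; rewrite card_ffun !card_ord.
Qed.

(** What matters later is linear growth in [k]: the number of monomials of q^k is then polynomial in
    [k]. *)
Lemma msizeX_le q k : (mmeasure mdeg (q ^+ k) <= k * mmeasure mdeg q + 1)%N.
Proof.
have [->|q0] := eqVneq q 0.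
  by case: k => [|k]; rewrite ?expr0 ?msize1 // exprS mul0r mmeasure0 leq0n.
elim: k => [|k IH]; first by rewrite expr0 msize1.
rewrite exprS msizeM ?expf_neq0 //.
apply: (leq_trans (leq_pred _)); rewrite mulSn -addnA leq_add2l; exact: IH.
Qed.

Lemma modulus_peval_le q z (M : R) (E : nat) : (mmeasure mdeg q <= E)%N ->
  (forall a, modulus (mcoeff a q) * mono (absv z) a <= M) ->
  modulus (peval q z) <= (E ^ n)%:R * M.
Proof.
move=> qE qM.
have M0 : 0 <= M.
  apply: le_trans (qM mnm0); rewrite mulr_ge0 ?modulus_ge0 ?mono_ge0 // => i.
  exact: absv_ge0.
rewrite /peval mevalE; apply: le_trans (modulus_sum _ _ _) _.
apply: (@le_trans _ _ (\sum_(m <- msupp q) M)).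
  apply: ler_sum => m _; apply: le_trans (qM m).
  rewrite modulusM modulus_prod; apply: ler_wpM2l; first exact: modulus_ge0.
  by rewrite /mono; under eq_bigr => i _ do rewrite modulusX.
rewrite big_const_seq count_predT iter_addr_0 -[leLHS]mulr_natl ler_wpM2r //
  ler_nat.
exact: size_msupp_le.
Qed.

End CauchyEstimates.

(** * Separating points from K by monomials *)

(** If x > 1 and y = ln x / (n+1), then x^k = exp(k y)^(n+1) >= (k y)^(n+1), which has order n + 1
    in [k] and outgrows (k D + 1)^n. *)
Lemma polynomial_growth_le1 (R : realType) (x : R) (n D : nat) :
  (forall k : nat, x ^+ k <= ((k * D + 1) ^ n)%:R) -> x <= 1.
Proof.
move=> xk; rewrite leNgt; apply/negP => x1.
have x0 : 0 < x by exact: lt_trans x1.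
pose y := ln x / n.+1%:R.
have y0 : 0 < y by rewrite divr_gt0 // ln_gt0.
have [k kP] : exists k : nat, (D.+1 ^ n)%:R / y ^+ n.+1 < k%:R.
  by eexists; exact: truncnS_gt.
have k0 : (0 < k)%N.
  rewrite -(ltr_nat R); apply: le_lt_trans kP.
  by rewrite divr_ge0 // exprn_ge0 // ltW.
have : (k%:R * y) ^+ n.+1 <= x ^+ k.
  have -> : x ^+ k = expR (k%:R * y) ^+ n.+1.
    rewrite -expRM_natl -{1}(lnK x0) -expRM_natl; congr expR.
    by rewrite /y mulrCA -[n.+1%:R * _]mulrC divfK.
  have ky0 : 0 <= k%:R * y by exact: mulr_ge0 (ltW y0).
  apply: lerXn2r; rewrite ?nnegrE ?expR_ge0 //.
  by apply: le_trans (expR_ge1Dx _); rewrite lerDr.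
move=> /le_trans/(_ (xk k)); rewrite leNgt => /negP; apply.
move: kP; rewrite ltr_pdivrMr ?exprn_gt0 // => kP.
apply: (@le_lt_trans _ _ (k%:R ^+ n * (D.+1 ^ n)%:R)).
  rewrite -natrX -natrM ler_nat -expnMn.
  by case: (n) => // n'; rewrite leq_exp2r // mulnS addnC leq_add2r.
by rewrite exprMn exprS [k%:R * _]mulrC -mulrA ltr_pM2l // exprn_gt0 // ltr0n.
Qed.

(* Summing the Cauchy estimates bounds |p(z)| by the sup of |p| on K up to the
   number of monomials; applying this to the powers of p removes that factor. *)
Lemma monomial_separation (R : realType) (n : nat) (K : set 'rV[C R]_n) (z :
  'rV[C R]_n) :
  K !=set0 -> reinhardt K -> polynomially_convex K -> ~ K z ->
  exists a, exists2 s : R, s < mono (absv z) a & forall w, K w ->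
    mono (absv w) a <= s.
Proof.
move=> [w0 Kw0] Krein Kconv nKz; apply: contrapT => nsep; apply: nKz.
rewrite Kconv => p /=; rewrite leNgt; apply/negP => sup_lt.
have [M KM Mlt] : exists2 M : R, forall w, K w -> modulus (peval p w) <= M &
  M < modulus (peval p z).
  move: sup_lt; set S := ereal_sup _ => sup_lt.
  have SK w : K w -> ((modulus (peval p w))%:E <= S)%E.
    by move=> Kw; apply: ereal_sup_ubound; exists w.
  (* The value +oo is not below a real number, and -oo is excluded by the point [w0] of K. *)
  case: S sup_lt SK => [r| |] //= Slt SK.
    by exists r => [w /SK|]; rewrite -?lee_fin -?lte_fin.
  by have := SK w0 Kw0.
have M0 : 0 <= M by exact: le_trans (modulus_ge0 _) (KM w0 Kw0).
pose D := mmeasure mdeg p.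
(* As no monomial separates z from K, each Cauchy bound for a term of p^k on K carries over to z. *)
have key k : modulus (peval p z) ^+ k <= ((k * D + 1) ^ n)%:R * M ^+ k.
  rewrite -modulusX -(rmorphXn (meval _)).
  apply: modulus_peval_le => [|a]; first exact: msizeX_le.
  have KMk w : K w -> modulus (mcoeff a (p ^+ k)) * mono (absv w) a <= M ^+ k.
    move=> Kw; apply: cauchy_estimate => phi.
    rewrite /peval rmorphXn modulusX lerXn2r ?nnegrE ?modulus_ge0 //.
    exact/KM/Krein.
  rewrite leNgt; apply/negP => lt; apply: nsep; exists a.
  have c0 : 0 < modulus (mcoeff a (p ^+ k)).
    rewrite lt0r modulus_ge0 andbT; apply/eqP => c0; move: lt.
    by rewrite c0 mul0r ltNge exprn_ge0.
  exists (M ^+ k / modulus (mcoeff a (p ^+ k))) => [|w /KMk].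
    by rewrite ltr_pdivrMr // mulrC.
  by rewrite ler_pdivlMr // mulrC.
have [M_eq0|Mn0] := eqVneq M 0.
  by have := key 1%N; rewrite M_eq0 expr1 mulr0 => /(lt_le_trans Mlt);
    rewrite M_eq0 ltxx.
have Mp : 0 < M by rewrite lt0r Mn0.
have : modulus (peval p z) / M <= 1.
  apply: (@polynomial_growth_le1 _ _ n D) => k.
  by rewrite expr_div_n ler_pdivrMr ?exprn_gt0.
by rewrite ler_pdivrMr // mul1r leNgt Mlt.
Qed.

(** * Monomial polyhedra between K and U *)

Lemma finite_pos_lower_bound (R : realType) (J : finType) (f : J -> R) :
  (forall j, 0 < f j) -> exists2 t : R, 0 < t & forall j, t <= f j.
Proof.
(* The 1 in the minimum covers an empty [J]. *)
move=> f0; exists (\big[Num.min/1]_j f j) => [|j]; last exact: bigmin_le_cond.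
by apply: lt_bigmin => // j _; exact: f0.
Qed.

Lemma finite_max_attained (R : realType) (J : finType) (f : J -> R) (j : J) :
  exists i, forall k, f k <= f i.
Proof. by exists [arg max_(i > j) f i]%O; case: arg_maxP => // i _ fi k;
  exact: fi. Qed.

(** Each point of a large polydisc outside U is cut off from K by a monomial with room to spare, and
    compactness leaves finitely many. The coordinate functions are added to confine z to the
    polydisc. *)
Lemma monomial_polyhedron (R : realType) (n : nat) (K U : set 'rV[C R]_n) :
  K !=set0 -> compact K -> reinhardt K -> polynomially_convex K -> open U ->
    K `<=` U ->
  exists (J : finType) (a : J -> multinom n) (b t : J -> R),
    [/\ forall j, 0 < t j,
        forall j, (0 < mdeg (a j))%N,
        forall i, exists j, a j = mnm1 i,
        forall z, K z -> forall j, mono (absv z) (a j) <= expR (b j - t j)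
      & forall z, (forall j, mono (absv z) (a j) <= expR (b j + t j)) -> U z].
Proof.
move=> K0 cK Krein Kconv oU KU.
have [r r0 Kr] := compact_absv_bounded cK.
pose I : choiceType := (multinom n * R * R)%type.
pose D : set I := [set u : I | [/\ 0 < u.2, (0 < mdeg u.1.1)%N &
  forall w, K w -> mono (absv w) u.1.1 <= expR (u.1.2 - u.2)]].
pose f (u : I) : set 'rV[C R]_n :=
  [set z | expR (u.1.2 + u.2) < mono (absv z) u.1.1].
(* The radius is exp(b + t) for the values b = ln r + 1 and t = 1 given to the coordinates below. *)
pose B : set 'rV[C R]_n := [set z | forall i, absv z i <= r * expR 2].
have cBU : compact (B `&` ~` U).
  apply: compact_closedI; first exact: compact_polydisc.
  exact: open_closedC.
have covBU : B `&` ~` U `<=` cover D f.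
  move=> z [_ nUz].
  have nKz : ~ K z by move/KU.
  have [a [s sz Ks]] := monomial_separation K0 Krein Kconv nKz.
  have s0 : 0 <= s.
    have [w Kw] := K0; apply: le_trans (Ks w Kw); apply: mono_ge0 => i.
    exact: absv_ge0.
  pose m := mono (absv z) a.
  (* Two levels with s < s1 < s2 < m; [s1] is positive even if s = 0, so its logarithm is
     meaningful. *)
  pose s1 := (s + m) / 2; pose s2 := (s1 + m) / 2.
  have sm : s < m by [].
  have s1_gt0 : 0 < s1 by rewrite /s1; lra.
  have s12 : s1 < s2 by rewrite /s2 /s1; lra.
  have s2m : s2 < m by rewrite /s2 /s1; lra.
  have s2_gt0 : 0 < s2 by exact: lt_trans s12.
  have lns : ln s1 < ln s2 by rewrite ltr_ln ?posrE.
  exists (a, (ln s1 + ln s2) / 2, (ln s2 - ln s1) / 2); rewrite /D /f /=.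
    split => /=; first by lra.
      (* The constant monomial is 1 everywhere and separates nothing. *)
      rewrite lt0n mdeg_eq0; apply/eqP => a0; have [w Kw] := K0.
      have := Ks w Kw; move: sz; rewrite a0 !mono_mnm0; lra.
    move=> w Kw; rewrite (_ : _ - _ = ln s1); last by lra.
    rewrite lnK ?posrE //; apply: le_trans (Ks w Kw) _; rewrite /s1; lra.
  rewrite (_ : _ + _ = ln s2); last by lra.
  by rewrite lnK ?posrE.
have fo u : D u -> open (f u) by move=> _; exact: open_mono.
move: cBU; rewrite compact_cover => /(_ I D f fo covBU) [D' D'D BUD'].
pose J : finType := ('I_n + seq_sub (finmap.enum_fset D'))%type.
exists J.
exists (fun j : J => match j with inl i => mnm1 i | inr u => (ssval u).1.1 end).
exists (fun j : J => match j with inl i => ln r + 1 | inr u =>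
  (ssval u).1.2 end).
exists (fun j : J => match j with inl i => 1 | inr u => (ssval u).2 end).
have DP (u : seq_sub (finmap.enum_fset D')) : D (ssval u).
  by have := D'D _ (ssvalP u); rewrite inE.
split => [[i|u]|[i|u]|i|z Kz [i|u]|z zJ] //=.
- by have [] := DP u.
- by rewrite mdeg1.
- by have [] := DP u.
- by exists (inl i).
- by rewrite mono_mnm1 addrK lnK ?posrE // Kr.
- by have [_ _] := DP u; apply.
apply: contrapT => nUz.
have Bz : B z.
  move=> i; have := zJ (inl i); rewrite mono_mnm1 -addrA expRD lnK ?posrE //.
have [u /= uD' fu] := BUD' z (conj Bz nUz).
have := zJ (inr (SeqSub uD')); rewrite /= leNgt => /negP; apply; exact: fu.
Qed.

(** Raising each monomial to the power [d] over its degree, with [d] the product of all degrees,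
    equalises the degrees. Powers at least 1 only widen the logarithmic margins. *)
Lemma homogeneous_monomial_polyhedron (R : realType) (n : nat) (K U : set 'rV[C
  R]_n) :
  K !=set0 -> compact K -> reinhardt K -> polynomially_convex K -> open U ->
    K `<=` U ->
  exists (J : finType) (d : nat) (a : J -> multinom n) (b : J -> R) (t : R),
    [/\ (0 < d)%N /\ 0 < t,
        forall j, mdeg (a j) = d,
        forall i, exists j, a j = mnm_muln (mnm1 i) d,
        forall z, K z -> forall j, mono (absv z) (a j) <= expR (b j - t)
      & forall z, (forall j, mono (absv z) (a j) <= expR (b j + t)) -> U z].
Proof.
move=> K0 cK Krein Kconv oU KU.
have [J [a [b [s [s0 a0 aX Kab abU]]]]] :=
  monomial_polyhedron K0 cK Krein Kconv oU KU.
have [t t0 ts] := finite_pos_lower_bound s0.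
pose d := (\prod_j mdeg (a j))%N.
have d0 : (0 < d)%N by apply: prodn_gt0 => j; exact: a0.
pose k j := (d %/ mdeg (a j))%N.
have dk j : (k j * mdeg (a j))%N = d
  by rewrite /k divnK // /d (bigD1 j) //= dvdn_mulr.
have k0 j : (0 < k j)%N.
  by rewrite lt0n; apply/eqP => kj; move: d0; rewrite -(dk j) kj.
have k1 j : 1 <= (k j)%:R :> R by rewrite ler1n.
exists J, d, (fun j => mnm_muln (a j) (k j)), (fun j => (k j)%:R * b j), t;
  split => //.
- by move=> j; rewrite mdegMn mulnC dk.
- by move=> i; have [j aj] := aX i; exists j; have := dk j;
  rewrite aj mdeg1 muln1 => ->.
- move=> z Kz j; rewrite mono_muln.
  apply: (@le_trans _ _ (expR (b j - s j) ^+ k j)).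
    apply: lerXn2r; rewrite ?nnegrE ?expR_ge0 ?Kab ?mono_ge0 //.
    by move=> i; exact: absv_ge0.
  rewrite -expRM_natl ler_expR mulrBr lerB // (le_trans (ts j)) //.
  by rewrite ler_peMl // ltW.
- move=> z zab; apply: abU => j.
  rewrite leNgt; apply/negP => lt; have := zab j;
    rewrite mono_muln leNgt => /negP; apply.
  apply: (@le_lt_trans _ _ (expR (b j + s j) ^+ k j)).
    rewrite -expRM_natl ler_expR mulrDr lerD2l // (le_trans (ts j)) //.
    by rewrite ler_peMl // ltW.
  by rewrite ltrXn2r ?expR_ge0 // -lt0n.
Qed.

(** * General position of the coefficients *)

Lemma avoid_hyperplanes (R : realType) (I J : finType) (lam : I -> J ->
  R) (b : J -> R)
    (eps : R) : (forall i, exists j, lam i j != 0) -> 0 < eps ->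
  exists2 b' : J -> R, forall j, `|b' j - b j| <= eps &
    forall i, \sum_j lam i j * b' j != 0.
Proof.
move=> lam0 eps0.
(* The curve b + (x, x^2, x^3, ...) meets each hyperplane finitely often. *)
pose P i : {poly R} := (\sum_j lam i j * b j)%:P + \sum_j lam i j *:
  'X^((enum_rank j).+1).
have PE i x : (P i).[x] = \sum_j lam i j * (b j + x ^+ (enum_rank j).+1).
  rewrite hornerD hornerC horner_sum -big_split /=; apply: eq_bigr => j _.
  by rewrite hornerZ hornerXn mulrDr.
have P0 i : P i != 0.
  have [j lij] := lam0 i; apply/eqP => /(congr1 (fun p : {poly R} =>
    p`_(enum_rank j).+1)).
  rewrite coefD coefC /= add0r coef0 coef_sum (bigD1 j) //= coefZ coefXn eqxx
    mulr1 big1.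
    by rewrite addr0 => /eqP; rewrite (negbTE lij).
  move=> k kj; rewrite coefZ coefXn eqSS;
    case: eqP => [/ord_inj/enum_rank_inj jk|]; last by rewrite mulr0.
  by rewrite jk eqxx in kj.
pose Q := \prod_i P i.
have Q0 : Q != 0 by apply/prodf_neq0 => i _; exact: P0.
(* For x <= e <= 1 all powers x^(k+1) are at most x, hence at most [eps]. *)
pose e := Num.min 1 eps.
have e0 : 0 < e by rewrite lt_min ltr01.
(* As many distinct points as the size of [Q], which exceeds its number of roots, so one of them is
   not a root. *)
pose rs := [seq e / k.+1%:R | k <- iota 0 (size Q)].
have rs_uniq : uniq rs.
  rewrite map_inj_uniq ?iota_uniq // =>
    k l /(mulfI (lt0r_neq0 e0))/invr_inj/eqP.
  by rewrite eqr_nat eqSS => /eqP.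
have /allPn[x] : ~~ all (root Q) rs.
  apply/negP => rt; have := max_poly_roots Q0 rt rs_uniq.
  by rewrite size_map size_iota ltnn.
move=> /mapP[k _ xE] Qx.
have x0 : 0 < x by rewrite xE divr_gt0.
have xe : x <= e by rewrite xE ler_pdivrMr // ler_peMr ?(ltW e0) // ler1n.
exists (fun j => b j + x ^+ (enum_rank j).+1) => [j|i].
  rewrite addrAC subrr add0r ger0_norm ?exprn_ge0 ?(ltW x0) //.
  apply: (@le_trans _ _ x); last by rewrite (le_trans xe) // ge_min lexx orbT.
  rewrite exprS ler_piMr ?(ltW x0) // exprn_ile1 ?(ltW x0) //.
  by rewrite (le_trans xe) // ge_min lexx.
rewrite -PE; move: Qx; rewrite /Q rootE horner_prod => /prodf_neq0; exact.
Qed.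

(** A matrix with n + 1 rows and n columns has a nonzero left kernel vector. Its entries sum to 0
    because every row of exponents sums to the same d > 0. *)
Lemma affine_dependency (R : realType) (n d : nat) (J : finType) (a : J ->
  multinom n)
    (s : 'I_n.+1 -> J) : (0 < d)%N -> (forall j, mdeg (a j) = d) ->
      injective s ->
  exists lam : J -> R,
    [/\ exists j, lam j != 0,
        forall j, lam j != 0 -> exists i, j = s i,
        \sum_j lam j = 0
      & forall l, \sum_j lam j * (a j l)%:R = 0].
Proof.
move=> d0 ad s_inj.
pose A : 'M[R]_(n.+1, n) := \matrix_(i, l) (a (s i) l)%:R.
have : kermx A != 0.
  by rewrite -mxrank_eq0 mxrank_ker subn_eq0 -ltnNge (leq_ltn_trans
    (rank_leq_col A)).
move=> /rowV0Pn[v /sub_kermxP vA v0].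
pose lam j := \sum_(i | s i == j) v ord0 i.
have lamE (f : J -> R) : \sum_j lam j * f j = \sum_i v ord0 i * f (s i).
  rewrite (partition_big s predT) //=; apply: eq_bigr => j _.
  by rewrite /lam mulr_suml; apply: eq_bigr => i /eqP ->.
have lama l : \sum_j lam j * (a j l)%:R = 0.
  rewrite lamE; have /rowP/(_ l) := vA; rewrite !mxE => vAl.
  by rewrite -[RHS]vAl; apply: eq_bigr => i _; rewrite mxE.
exists lam; split => //.
- have /rV0Pn[i vi] := v0; exists (s i).
  rewrite /lam (bigD1 i) //= big1 ?addr0 // => k /andP[/eqP/s_inj -> ].
  by rewrite eqxx.
- move=> j lj; have [/existsP[i /eqP <-]|] := boolP [exists i, s i == j];
  first by exists i.
  rewrite negb_exists => /forallP sj; move: lj; rewrite /lam big1 ?eqxx // => i.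
  by rewrite (negbTE (sj i)).
- have : \sum_l \sum_j lam j * (a j l)%:R = 0 by rewrite big1.
  rewrite exchange_big /=; under eq_bigr =>
    j _ do rewrite -mulr_sumr -natr_sum -mdegE ad.
  by rewrite -mulr_suml => /eqP;
    rewrite mulf_eq0 pnatr_eq0 (gtn_eqF d0) orbF => /eqP.
Qed.

(** A zero coordinate must have exponent 0 here, so the default value of [ln] at 0 is multiplied by
    0. *)
Lemma mono_expR (R : realType) (n : nat) (x : 'I_n -> R) (a : multinom n) :
  (forall i, 0 <= x i) -> 0 < mono x a ->
  mono x a = expR (\sum_i (a i)%:R * ln (x i)).
Proof.
move=> x0; rewrite /mono => pos; rewrite expR_sum; apply: eq_bigr => i _.
rewrite expRM_natl; have [xi|xi] := eqVneq (x i) 0; last first.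
  by rewrite lnK // posrE lt0r xi x0.
have [->|ai] := eqVneq (a i) 0%N; first by rewrite !expr0.
by move: pos; rewrite (bigD1 i) //= xi expr0n (negbTE ai) mul0r ltxx.
Qed.

(** An affine dependency [lam] makes the combination of the logarithms of the n + 1 terms equal to
    the constant sum of lam_j b'_j. This is nonzero for generic [b'], whereas terms all close to M
    would make it small. *)
Lemma general_position_gap (R : realType) (n d : nat) (J : finType) (a : J ->
  multinom n)
    (b : J -> R) (eps : R) : (0 < d)%N -> (forall j, mdeg (a j) = d) ->
      0 < eps ->
  exists b' : J -> R, exists delta : R,
    [/\ forall j, `|b' j - b j| <= eps, 0 < delta &
      forall (x : 'I_n -> R) (M : R) (A : {set J}),
        (forall i, 0 <= x i) -> 0 < M ->
        (forall j, j \in A ->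
          expR (- delta) * M <= expR (b' j) * mono x (a j) <= M) ->
        (#|A| <= n)%N].
Proof.
move=> d0 ad eps0.
pose I : finType := {s : {ffun 'I_n.+1 -> J} | injectiveb s}.
have [lam lamP] := choice (fun s : I =>
  @affine_dependency R n d J a (val s) d0 ad (injectiveP _ (valP s))).
have [b' b'b b'0] := avoid_hyperplanes b (fun s => let: And4 h _ _ _ :=
  lamP s in h) eps0.
(* The added 1 yields the strict inequality that ends the proof. *)
pose W s := 1 + \sum_j `|lam s j|.
have W0 s : 0 < W s by rewrite ltr_pwDl // sumr_ge0.
have [delta delta0 deltaP] : exists2 t : R, 0 < t &
  forall s, t <= `|\sum_j lam s j * b' j| / W s.
  by apply: finite_pos_lower_bound => s; rewrite divr_gt0 // normr_gt0.
exists b', delta; split => // x M A x0 M0 AM.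
rewrite leqNgt; apply/negP => nA.
(* The first n + 1 elements of [A], which exist if [A] has more than n. *)
pose s0 := [ffun i : 'I_n.+1 => enum_val (widen_ord nA i)].
have s0_inj : injectiveb s0.
  by apply/injectiveP => i j;
    rewrite !ffunE => /enum_val_inj /(congr1 val) /= /ord_inj.
pose s : I := Sub s0 s0_inj.
have [_ lamA lam0 lama] := lamP s.
have jA j : lam s j != 0 -> j \in A.
  by move=> /lamA[i ->]; rewrite ffunE enum_valP.
pose u i := ln (x i).
(* The logarithmic distance of the j-th term below M; ln M and [u] cancel from its
   [lam]-combination. *)
pose y j := ln M - b' j - \sum_i (a j i)%:R * u i.
have yP j : lam s j != 0 -> `|y j| <= delta.
  move=> /jA/AM/andP[lo hi].
  have mp : 0 < mono x (a j).
    rewrite -(pmulr_rgt0 _ (expR_gt0 (b' j))); apply: lt_le_trans lo.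
    by rewrite mulr_gt0 // expR_gt0.
  move: lo hi; rewrite (mono_expR x0 mp) -expRD -{1 2}(lnK M0) -expRD !ler_expR
    => lo hi.
  by rewrite ler_norml /y /u; apply/andP; split; lra.
have sumE : \sum_j lam s j * b' j = - \sum_j lam s j * y j.
  under [in RHS]eq_bigr => j _ do rewrite /y !mulrBr.
  rewrite !sumrB -mulr_suml lam0 mul0r.
  under [X in _ = - (_ - X)]eq_bigr => j _ do rewrite mulr_sumr.
  rewrite exchange_big /= [X in _ = - (_ - X)]big1 => [|i _];
    first by rewrite subr0 sub0r opprK.
  by under eq_bigr => j _ do rewrite mulrA; rewrite -mulr_suml lama mul0r.
have := deltaP s; rewrite ler_pdivlMr // sumE normrN leNgt => /negP; apply.
apply: le_lt_trans (ler_norm_sum _ _ _) _.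
apply: (@le_lt_trans _ _ (delta * \sum_j `|lam s j|)); last first.
  by rewrite ltr_pM2l // ltrDr.
rewrite mulr_sumr; apply: ler_sum => j _; rewrite normrM mulrC.
have [->|lj] := eqVneq (lam s j) 0; first by rewrite normr0 !mulr0.
by rewrite ler_wpM2r // yP.
Qed.

(** * Level gaps and dominant terms of symmetric functions *)

Section SymmetricSums.
Variables (R : realType) (J : finType).

(* Among the n + 1 nested nonempty level sets at heights M, rho M, ...,
   rho^n M, the last of which has at most n elements, two consecutive ones
   coincide. *)
Lemma level_gap (y : J -> R) (M rho : R) (n : nat) :
  0 < rho < 1 -> 0 < M -> (exists j, y j = M) ->
  (#|[set j | (rho ^+ n * M <= y j)%R]%SET| <= n)%N ->
  exists2 i, (i < n)%N & let F := [set j | (rho ^+ i * M <= y j)%R]%SET in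
    (0 < #|F| <= n)%N /\ forall j, j \notin F -> y j < rho * (rho ^+ i * M).
Proof.
move=> /andP[rho0 rho1] M0 [j0 yj0].
pose F i := [set j | (rho ^+ i * M <= y j)%R]%SET.
rewrite -/(F n) => Fn.
have subF i k : (i <= k)%N -> F i \subset F k.
  move=> ik; apply/fintype.subsetP => j; rewrite !inE; apply: le_trans.
  by rewrite ler_wpM2r ?(ltW M0) // ler_wiXn2l // ltW.
have F0 i : (0 < #|F i|)%N.
  apply/card_gt0P; exists j0; rewrite inE yj0 ler_piMl ?(ltW M0) //.
  by rewrite exprn_ile1 // ltW.
have [i iP] : exists i : 'I_n, #|F i.+1| == #|F i|.
  apply/existsP; rewrite -[X in is_true X]negbK negb_exists;
    apply/negP => /forallP ne.
  suff H i : (i <= n)%N -> (i < #|F i|)%N by have := H n (leqnn n);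
    rewrite ltnNge Fn.
  elim: i => [_|i IH ltin]; first exact: F0.
  apply: leq_ltn_trans (IH (ltnW ltin)) _.
  rewrite ltn_neqAle subset_leq_card ?subF // andbT eq_sym.
  exact: (ne (Ordinal ltin)).
exists i => //; split; first
  by rewrite F0 (leq_trans (subset_leq_card (subF _ _ (ltnW (ltn_ord i))))).
move=> j jF; rewrite mulrA -exprS ltNge; apply: contra jF => yj.
have FE : F i = F i.+1 by apply/eqP; rewrite eqEcard subF //= (eqP iP).
by rewrite -/(F i) FE inE.
Qed.

(** Passing from [F] to [G] trades factors of at least [c] for equally many factors of at most rho
    c, and at least one is traded. *)
Lemma prod_dominated (y : J -> R) (c rho : R) (F G : {set J}) :
  (forall j, 0 <= y j) -> 0 < rho < 1 -> 0 <= c ->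
  (forall j, j \in F -> c <= y j) -> (forall j, j \notin F -> y j <= rho * c) ->
  #|G| = #|F| -> G != F ->
  \prod_(j in G) y j <= rho * \prod_(j in F) y j.
Proof.
move=> y0 /andP[rho0 rho1] c0 yF ynF GF neGF.
have cardD : #|G :\: F| = #|F :\: G|.
  apply: (@addnI #|G :&: F|); rewrite cardsID GF -(cardsID G F) finset.setIC //.
have D0 : (0 < #|F :\: G|)%N.
  rewrite card_gt0 finset.setD_eq0; apply/negP => FG; move/negP: neGF; apply.
  by rewrite eq_sym eqEcard FG GF leqnn.
rewrite (big_setID F) /= [in leRHS](big_setID G) /= [F :&: G]finset.setIC
  mulrCA.
apply: ler_wpM2l; first by apply: prodr_ge0 => j _.
apply: (@le_trans _ _ ((rho * c) ^+ #|G :\: F|)).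
  rewrite -prodr_const; apply: ler_prod => j; rewrite !inE => /andP[jF _].
  by rewrite y0 ynF.
rewrite cardD exprMn; apply: ler_pM; rewrite ?exprn_ge0 ?(ltW rho0) //.
  by case: #|_| D0 => // k _;
    rewrite exprS ler_piMr ?(ltW rho0) // exprn_ile1 ?ltW.
rewrite -prodr_const; apply: ler_prod => j; rewrite !inE => /andP[_ jF].
by rewrite c0 yF.
Qed.

(** The elementary symmetric function of order [k] in the powers f_j^e. *)
Definition symsum (V : comNzRingType) (f : J -> V) (k e : nat) : V :=
  \sum_(G : {set J} | #|G| == k) \prod_(j in G) f j ^+ e.

Lemma sumr_set_le (P : pred {set J}) (g : {set J} -> R) (c : R) : 0 <= c ->
  (forall G, P G -> g G <= c) -> \sum_(G | P G) g G <= (2 ^ #|J|)%:R * c.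
Proof.
move=> c0 gc; apply: (@le_trans _ _ (\sum_(G : {set J}) c)).
  rewrite big_mkcond; apply: ler_sum => G _; case: ifP => // PG; exact: gc.
rewrite sumr_const -[leLHS]mulr_natl ler_wpM2r // ler_nat.
by rewrite -[X in (_ <= 2 ^ X)%N]cardsT -card_powerset powersetT cardsT.
Qed.

Lemma symsum_upper (f : J -> C R) (M : R) (k e : nat) : 0 <= M ->
  (forall j, modulus (f j) <= M) ->
  modulus (symsum f k e) <= (2 ^ #|J|)%:R * M ^+ (e * k).
Proof.
move=> M0 fM; apply: le_trans (modulus_sum _ _ _) _.
apply: sumr_set_le => [|G /eqP <-]; first exact: exprn_ge0.
rewrite modulus_prod exprM -prodr_const; apply: ler_prod => j _.
by rewrite modulus_ge0 /= modulusX; apply: lerXn2r;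
  rewrite ?nnegrE ?modulus_ge0.
Qed.

(** The term of [F] dominates: each of the at most 2^|J| others is smaller by a factor rho^e, so
    together they reach at most half of it. *)
Lemma symsum_lower (f : J -> C R) (c rho : R) (F : {set J}) (e : nat) :
  0 < rho < 1 -> 0 <= c -> (2 ^ #|J|)%:R * rho ^+ e <= 1 / 2 ->
  (forall j, j \in F -> c <= modulus (f j)) ->
  (forall j, j \notin F -> modulus (f j) <= rho * c) ->
  c ^+ (e * #|F|) / 2 <= modulus (symsum f #|F| e).
Proof.
move=> rhoP c0 rhoe fF fnF.
pose Q := \prod_(j in F) modulus (f j).
have Q0 : 0 <= Q by apply: prodr_ge0 => j _; exact: modulus_ge0.
have cQ : c ^+ (e * #|F|) <= Q ^+ e.
  rewrite mulnC exprM; apply: lerXn2r; rewrite ?nnegrE ?exprn_ge0 //.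
  by rewrite -prodr_const; apply: ler_prod => j jF; rewrite c0 fF.
have modE (G : {set J}) : modulus (\prod_(j in G) f j ^+ e) = (\prod_(j in G)
  modulus (f j)) ^+ e.
  by rewrite modulus_prod -prodrXl; apply: eq_bigr => j _; rewrite modulusX.
rewrite /symsum (bigD1 F) //=; set T := \sum_(G | _) _.
have Tle : modulus T <= Q ^+ e / 2.
  apply: le_trans (modulus_sum _ _ _) _.
  apply: (@le_trans _ _ ((2 ^ #|J|)%:R * (rho ^+ e * Q ^+ e))).
    have rho0 : 0 <= rho by case/andP: rhoP => /ltW.
    apply: sumr_set_le => [|G /andP[/eqP GF neGF]];
      first by rewrite mulr_ge0 ?exprn_ge0.
    rewrite modE -exprMn; apply: lerXn2r; rewrite ?nnegrE ?mulr_ge0 //.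
      by apply: prodr_ge0 => j _; exact: modulus_ge0.
    by apply: prod_dominated rhoP c0 fF fnF GF neGF => j; exact: modulus_ge0.
  by rewrite mulrA [leRHS]mulrC -[2^-1]mul1r ler_wpM2r // exprn_ge0.
have := modulusD (\prod_(j in F) f j ^+ e + T) (- T).
rewrite addrK modulusN modE -/Q; lra.
Qed.

End SymmetricSums.

(** * The symmetric functions as homogeneous polynomials *)

Section SymmetricPolynomials.
Variables (R : realType) (n d : nat) (J : finType) (a : J ->
  multinom n) (b : J -> R).

(** With this coefficient the logarithm of the modulus has constant term [b j]. *)
Definition scaled_monomial (j : J) : mpoly n (C R) :=
  ((expR (b j))%:C)%C *: mpolyX (C R) (a j).

Lemma modulus_scaled_monomial j z :
  modulus (peval (scaled_monomial j) z) = expR (b j) * mono (absv z) (a j).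
Proof.
rewrite /scaled_monomial /peval mevalZ modulusM modulus_real ?expR_ge0 //.
by congr (_ * _); exact: modulus_pevalX.
Qed.

Lemma peval_symsum k e z : peval (symsum scaled_monomial k e) z =
  symsum (fun j => peval (scaled_monomial j) z) k e.
Proof.
rewrite /peval /symsum rmorph_sum; apply: eq_bigr => G _.
by rewrite rmorph_prod; apply: eq_bigr => j _; rewrite rmorphXn.
Qed.

Lemma homogeneous_symsum k e : (forall j, mdeg (a j) = d) ->
  homogeneous (d * (e * k)) (symsum scaled_monomial k e).
Proof.
move=> ad; apply: rpred_sum => G /eqP Gk.
have -> : (d * (e * k) = \sum_(j in G) d * e)%N.
  by rewrite sum_nat_const Gk mulnA mulnC.
elim/big_rec2: _ => [|j p m _ IH]; first exact: dhomog1.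
apply: dhomogM => //; apply: dhomogMn; apply: dhomogZ.
by rewrite dhomogX; apply/eqP; exact: ad.
Qed.

End SymmetricPolynomials.

(** * Compactness of monomial polyhedra *)

Lemma closed_monomial_polyhedron (R : realType) (n : nat) (J : finType)
    (a : J -> multinom n) (b : J -> R) (c : R) :
  closed [set z | forall j, expR (b j) * mono (absv z) (a j) <= c].
Proof.
have -> : [set z | forall j, expR (b j) * mono (absv z) (a j) <= c] =
    \bigcap_j [set z | mono (absv z) (a j) <= c / expR (b j)].
  by apply/seteqP; split => z zP j; [move=> _|]; have := zP j;
    rewrite /= ler_pdivlMr ?expR_gt0 // mulrC; [|exact].
by apply: closed_bigI => j _; exact: closed_mono.
Qed.

(** The pure powers z_i^d among the monomials bound every coordinate. *)
Lemma compact_monomial_polyhedron (R : realType) (n d : nat) (J : finType)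
    (a : J -> multinom n) (b : J -> R) (c : R) :
  (0 < d)%N -> (forall i, exists j, a j = mnm_muln (mnm1 i) d) ->
  compact [set z | forall j, expR (b j) * mono (absv z) (a j) <= c].
Proof.
(* Since r >= 1, only |z_i| > 1 needs an argument, and then |z_i| <= |z_i|^d. *)
move=> d0 aX; pose r := 1 + \sum_j `|c / expR (b j)|.
have r1 : 1 <= r by rewrite lerDl sumr_ge0.
refine (subclosed_compact (@closed_monomial_polyhedron _ _ _ a b c)
  (compact_polydisc (r := r)) _).
move=> z /= zP i; have [j aj] := aX i.
have : absv z i ^+ d <= r.
  rewrite -(mono_mnm1 (absv z)) -mono_muln -aj.
  apply: (@le_trans _ _ (c / expR (b j)));
    first by rewrite ler_pdivlMr ?expR_gt0 // mulrC.
  apply: (le_trans (ler_norm _)).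
  by rewrite /r (bigD1 j) //= addrCA lerDl addr_ge0 // sumr_ge0.
have [z1|z1] := leP (absv z i) 1; first by move=> _; exact: le_trans r1.
by apply: le_trans; rewrite -(prednK d0) exprS ler_peMr ?absv_ge0 // exprn_ege1
  // ltW.
Qed.

(** * Construction of the n polynomials *)

(** If M > 0 is the maximum of the |f_j(z)|, then (rho^n M)^q / 2 <= max |p_k(z)| <= 2^|J| M^q. On
    K, M <= exp(-t/2), while M > exp(t/2) off the compact set [Q] inside U, so a large [q]
    decides. *)
Lemma special_polyhedron (R : realType) (n : nat) (K U : set 'rV[C R]_n) :
  (0 < n)%N ->
  K !=set0 -> compact K -> reinhardt K -> polynomially_convex K -> open U ->
    K `<=` U ->
  exists (d : nat) (p : 'I_n -> mpoly n (C R)),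
    [/\ forall k, homogeneous d (p k),
        forall z : 'rV[C R]_n, (forall k, peval (p k) z = 0) <-> z = 0,
        K `<=` [set z | forall k, modulus (peval (p k) z) < 1]
      & relatively_compact_in [set z | forall k, modulus (peval (p k) z) < 1]
        U].
Proof.
move=> n0 K0 cK Krein Kconv oU KU.
have [J [d [a [b0 [t [[d0 t0] ad aX Kab abU]]]]]] :=
  homogeneous_monomial_polyhedron K0 cK Krein Kconv oU KU.
have t2 : 0 < t / 2 by rewrite divr_gt0.
(* The coefficients exp(-b0 j) move the levels to 1; perturbing them costs half of the margin
   [t]. *)
have [b [delta [bb0 delta0 gap]]] := general_position_gap (fun j =>
  - b0 j) d0 ad t2.
pose f := scaled_monomial a b.
pose y z j := modulus (peval (f j) z).
have yE z j : y z j = expR (b j) * mono (absv z) (a j)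
  by exact: modulus_scaled_monomial.
have y0 z j : 0 <= y z j by exact: modulus_ge0.
(* n sig <= delta keeps rho^n M within reach of [gap], and n sig <= t/4 keeps rho^n M above exp(t/4)
   when M > exp(t/2). *)
pose sig := Num.min delta (t / 4) / n%:R.
have nR0 : 0 < n%:R :> R by rewrite ltr0n.
have sig0 : 0 < sig by rewrite divr_gt0 // lt_min delta0 divr_gt0.
have nsig : n%:R * sig = Num.min delta (t / 4)
  by rewrite mulrC divfK ?lt0r_neq0.
pose rho := expR (- sig).
have rhoP : 0 < rho < 1 by rewrite expR_gt0 /= expR_lt1 oppr_lt0.
have rhon : rho ^+ n = expR (- (n%:R * sig)) by rewrite -expRM_natl mulrN.
pose c := (2 ^ #|J|)%:R * 2 : R.
have c2 : 2 <= c by rewrite /c ler_peMl // ler1n expn_gt0.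
have [m mP] : exists m : nat, c / sig < m%:R by eexists; exact: truncnS_gt.
have big_e (e : nat) : (m <= e)%N -> c < expR (e%:R * sig).
  move=> me; apply: lt_le_trans (expR_ge1Dx _).
  move: mP; rewrite ltr_pdivrMr // => mP.
  have : m%:R * sig <= e%:R * sig by rewrite ler_wpM2r ?ler_nat // ltW.
  lra.
(* The factorial makes q/(k+1) an integer for every index [k] below n, and the factor [m] makes
   these exponents large. All p_k then have degree d q. *)
pose q := (m * n`!)%N; pose e (k : 'I_n) := (m * (n`! %/ k.+1))%N.
have ek k : (e k * k.+1)%N = q.
  by rewrite /e /q -mulnA divnK // dvdn_fact //= ltn_ord.
have me k : (m <= e k)%N.
  by rewrite /e leq_pmulr // divn_gt0 // dvdn_leq ?fact_gt0 // dvdn_fact //=.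
have m0 : (0 < m)%N.
  by rewrite -(ltr_nat R) (le_lt_trans _ mP) // divr_ge0 // ?ltW // (lt_le_trans
    _ c2).
have mq : (m <= q)%N by rewrite leq_pmulr // fact_gt0.
have q0 : (0 < q)%N by exact: leq_trans mq.
pose p (k : 'I_n) := symsum f k.+1 (e k).
have pE k z : peval (p k) z = symsum (fun j =>
  peval (f j) z) k.+1 (e k) by exact: peval_symsum.
have lower z M : 0 < M -> (forall j, y z j <= M) -> (exists j, y z j = M) ->
    exists k, (rho ^+ n * M) ^+ q / 2 <= modulus (peval (p k) z).
  move=> M0 yM yexM.
  have card : (#|[set j | (rho ^+ n * M <= y z j)%R]%SET| <= n)%N.
    apply: (gap (absv z) M) => // [i|j]; first exact: absv_ge0.
    rewrite inE -yE yM andbT; apply: le_trans;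
      rewrite ler_pM2r // rhon ler_expR lerN2.
    by rewrite nsig ge_min lexx.
  have [i ltin [/andP[F0 Fn] nF]] := level_gap rhoP M0 yexM card.
  move: F0 Fn nF; set F := [set j | _]%SET => F0 Fn nF.
  (* The order of the symmetric function is |F|, so its index is |F| - 1. *)
  have ltFn : (#|F|.-1 < n)%N by rewrite prednK.
  exists (Ordinal ltFn); rewrite pE.
  set k := Ordinal ltFn.
  have kF : k.+1 = #|F| by rewrite /= prednK.
  have rho0 : 0 < rho by case/andP: rhoP.
  have ci : rho ^+ n * M <= rho ^+ i * M.
    have rho1 : rho <= 1 by case/andP: rhoP => _ /ltW.
    by rewrite ler_pM2r // (ler_wiXn2l (ltW rho0) rho1) // ltnW.
  apply: (@le_trans _ _ ((rho ^+ i * M) ^+ q / 2)).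
    rewrite ler_pM2r ?invr_gt0 //; apply: lerXn2r;
      rewrite ?nnegrE ?mulr_ge0 ?exprn_ge0 ?(ltW rho0) ?(ltW M0) //.
  rewrite -(ek k) kF; apply: (symsum_lower rhoP).
  - by rewrite mulr_ge0 ?exprn_ge0 ?(ltW rho0) ?(ltW M0).
  - rewrite /rho -expRM_natl mulrN expRN ler_pdivrMr ?expR_gt0 //.
    by have := big_e _ (me k); rewrite /c; lra.
  - by move=> j; rewrite inE.
  - by move=> j /nF /ltW.
have upper z M k : 0 <= M -> (forall j, y z j <= M) ->
    modulus (peval (p k) z) <= (2 ^ #|J|)%:R * M ^+ q.
  by move=> M0 yM; rewrite pE -(ek k); exact: symsum_upper.
pose Q := [set z : 'rV[C R]_n | forall j, expR (b j) * mono (absv z) (a j) <=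
  expR (t / 2)].
have cQ : compact Q by exact: compact_monomial_polyhedron d0 aX.
have QU : Q `<=` U.
  move=> z zQ; apply: abU => j; have := zQ j; have := bb0 j.
  rewrite ler_norml => /andP[lo hi] le.
  have : mono (absv z) (a j) <= expR (t / 2 - b j).
    by rewrite expRD expRN ler_pdivlMr ?expR_gt0 // mulrC.
  by move=> /le_trans; apply; rewrite ler_expR; lra.
have max_y z j : 0 < y z j ->
  exists M, [/\ y z j <= M, 0 < M, forall i, y z i <= M & exists i, y z i = M].
  move=> yj; have [i0 i0P] := finite_max_attained (y z) j.
  exists (y z i0); split; [exact: i0P | exact: lt_le_trans yj (i0P j) | exact:
    i0P |].
  by exists i0.
exists (d * q)%N, p; split.
- by move=> k; rewrite -(ek k); exact: homogeneous_symsum.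
- move=> z; split => [pz|-> k]; last first.
    apply: modulus_eq0; apply/eqP; rewrite eq_le modulus_ge0 andbT.
    apply: le_trans (upper 0 0 k _ _) _ => // [j|];
      last by rewrite expr0n (gtn_eqF q0) mulr0.
    rewrite yE /mono (_ : \prod_i _ = 0) ?mulr0 //; apply/eqP/prodf_eq0.
    have [i ai] : exists i, a j i != 0%N.
      apply/existsP; rewrite -negb_forall; apply/negP => /forallP a0.
      by have := d0; rewrite -(ad j) mdegE big1 // => i _; exact/eqP.
    by exists i => //; rewrite /absv mxE modulus0 expr0n (negbTE ai).
  (* If some f_j(z) were nonzero, the lower bound would make some p_k(z) nonzero. *)
  have yz j : y z j = 0.
    apply/eqP; rewrite eq_le y0 andbT leNgt; apply/negP => yj.
    have [M [_ M0 yM exM]] := max_y z j yj.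
    have [k] := lower z M M0 yM exM; rewrite pz modulus0 leNgt => /negP; apply.
    by rewrite divr_gt0 // exprn_gt0 // mulr_gt0 // exprn_gt0 // expR_gt0.
  apply/rowP => i; rewrite mxE; apply: modulus_eq0.
  have [j aj] := aX i; have := yz j; rewrite yE aj mono_muln mono_mnm1 => /eqP.
  by rewrite mulf_eq0 (gt_eqF (expR_gt0 _)) /= expf_eq0 d0 => /eqP.
- move=> z Kz k /=.
  apply: le_lt_trans (upper z (expR (- (t / 2))) k (expR_ge0 _) _) _.
    move=> j; rewrite yE; have := bb0 j; rewrite ler_norml => /andP[lo hi].
    apply: (@le_trans _ _ (expR (b j) * expR (b0 j - t))).
      by rewrite ler_pM2l ?expR_gt0 // Kab.
    by rewrite -expRD ler_expR; lra.
  rewrite -expRM_natl mulrN expRN ltr_pdivrMr ?expR_gt0 // mul1r.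
  apply: (@lt_trans _ _ c); first
    by rewrite /c ltr_pMr // ?ltr1n // ltr0n expn_gt0.
  apply: lt_le_trans (big_e _ mq) _; rewrite ler_expR ler_wpM2l //.
  have : sig <= n%:R * sig by rewrite ler_peMl ?(ltW sig0) // ler1n.
  by rewrite nsig => /le_trans; apply; rewrite ge_min; apply/orP; right; lra.
- suff AQ : closure [set z | forall k, modulus (peval (p k) z) < 1] `<=` Q.
    split; last exact: subset_trans AQ QU.
    by refine (subclosed_compact _ cQ AQ); exact: closed_closure.
  have /closure_id -> : closed Q by exact: closed_monomial_polyhedron.
  apply: closure_subset => z /= pz j; rewrite -yE leNgt; apply/negP => yj.
  have [M [yjM M0 yM exM]] := max_y z j (lt_trans (expR_gt0 _) yj).
  have [k] := lower z M M0 yM exM.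
  rewrite leNgt => /negP; apply; apply: (lt_le_trans (pz k)).
  (* Here (rho^n M)^q >= exp(q sig) > c >= 2, which absorbs the division by 2. *)
  rewrite ler_pdivlMr // mul1r; apply: (le_trans c2).
  apply: (le_trans (ltW (big_e _ mq))); rewrite expRM_natl.
  have rho_ge0 : 0 <= rho by exact: expR_ge0.
  apply: lerXn2r; rewrite ?nnegrE ?expR_ge0 ?mulr_ge0 ?exprn_ge0 ?(ltW M0) //.
  apply: (@le_trans _ _ (rho ^+ n * expR (t / 2))); last first.
    by rewrite ler_pM2l ?(le_trans (ltW yj)) // exprn_gt0 // expR_gt0.
  rewrite rhon nsig -expRD ler_expR.
  have : sig <= n%:R * sig by rewrite ler_peMl ?(ltW sig0) // ler1n.
  rewrite nsig; have : Num.min delta (t / 4) <= t / 4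
    by rewrite ge_min lexx orbT.
  lra.
Qed.

Theorem corollary1p3 (R : realType) (n : nat) (K U : set 'rV[C R]_n)
  (K_neq0 : K !=set0)
  (K_compact : compact K)
  (K_reinhardt : reinhardt K)
  (K_pconvex : polynomially_convex K)
  (U_open : open U)
  (KU : K `<=` U) :
  exists (d : nat) (p : 'I_n -> mpoly n (C R)),
    [/\ forall k, homogeneous d (p k),
        forall z : 'rV[C R]_n, (forall k, peval (p k) z = 0) <-> z = 0,
        K `<=` [set z | forall k, modulus (peval (p k) z) < 1]
      & relatively_compact_in [set z | forall k, modulus (peval (p k) z) < 1] U].
Proof.
case: n => [|n] in K U K_neq0 K_compact K_reinhardt K_pconvex U_open KU *; last first.
  exact: special_polyhedron.
(* For n = 0 the space is a single point, so U is everything and the empty family of polynomials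
   works. *)
have UT z : U z.
  have [w Kw] := K_neq0.
  by rewrite (_ : z = w); [exact: KU | apply/rowP; case].
exists 0%N, (fun _ => 0); split; [by case| |by move=> z _; case|].
  by move=> z; split => _; [apply/rowP|]; case.
split; last by move=> z _; exact: UT.
have := @compact_polydisc R 0 0; rewrite (_ : [set z | _] = setT); last first.
  by apply/seteqP; split => // z _; case.
by move=> cT; apply: (subclosed_compact _ cT) => //; exact: closed_closure.
Qed.
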